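(* Let $\mathcal{M}$ be an arbitrary variety of groups, $\mathcal{A}$ the variety of abelian groups, and for $s\in\mathbb{N}$ let $\mathcal{A}_s$ be the variety of abelian groups of exponent $s$. (1) Let $G\in\mathcal{M}$ be an $m$-generated group of exponent $e$. Then $G$ embeds in a $4$-generated group $H\in\mathcal{M}\mathcal{A}_s$, where $s=e^{m+1}$, such that $H$ has exponent $e^{m+2}$. (2) Let $G\in\mathcal{M}$ be a finite group. Then $G$ embeds in some $4$-generated finite group $H\in\mathcal{M}\mathcal{A}$. In particular, every finite solvable group $G$ of derived length $l$ embeds in some $4$-generated finite solvable group $H$ of derived length $l+1$, and for every prime $p$, every finite $p$-group $G$ of derived length $l$ embeds in some $4$-generated finite $p$-group $H$ of derived length $l+1$.
   Context: A group is $k$-generated if it can be generated by $k$ elements (not necessarily distinct). A group is said to have exponent $n$ (for a positive integer $n$) if it satisfies the identity $x^n=1$; thus $\mathcal{A}_s$ consists of the abelian groups satisfying $x^s=1$. For varieties of groups $\mathcal{M}$ and $\mathcal{N}$, the product variety $\mathcal{M}\mathcal{N}$ consists of all groups $H$ having a normal subgroup $N\in\mathcal{M}$ with $H/N\in\mathcal{N}$. *)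

(* Defs.v *)
From HB Require Import structures.
From mathcomp Require Import all_boot all_fingroup all_solvable.
From mathcomp Require Import generic_quotient.

Set Implicit Arguments.
Unset Strict Implicit.
Unset Printing Implicit Defensive.

Local Open Scope group_scope.
Local Open Scope quotient_scope.

Definition group_class := groupType -> Prop.

(* Terms in countably many variables; they denote the elements of the free
   group of countable rank, and w is read as the law w = 1. *)
Inductive word : Type :=
  | WVar of nat
  | WOne
  | WMul of word & word
  | WInv of word.

Fixpoint word_eval (G : groupType) (x : nat -> G) (w : word) : G :=
  match w with
  | WVar i => x i
  | WOne => 1
  | WMul u v => word_eval x u * word_eval x v
  | WInv u => (word_eval x u)^-1
  end.

Definition satisfies_law (G : groupType) (w : word) : Prop :=
  forall x : nat -> G, word_eval x w = 1.

Definition is_variety (M : group_class) : Prop :=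
  exists W : word -> Prop,
    forall G : groupType, M G <-> (forall w, W w -> satisfies_law G w).

(* "Exponent n" means that the identity x^n = 1 holds; n is not required to be
   the least such integer. *)
Definition has_exponent (n : nat) : group_class :=
  fun G => forall x : G, x ^+ n = 1.

Definition abelian_variety : group_class :=
  fun G => forall x y : G, x * y = y * x.

Definition abelian_exp_variety (s : nat) : group_class :=
  fun G => abelian_variety G /\ has_exponent s G.

Record normal_subgroup (H : groupType) := NormalSubgroup {
  ns_pred :> {pred H};
  ns_group : group_closed ns_pred;
  ns_normal : forall x y : H, x \in ns_pred -> x ^ y \in ns_pred
}.

Section SubgroupAndQuotient.

Variables (H : groupType) (N : normal_subgroup H).

Definition ns_sub : Type := {x : H | x \in N}.

HB.instance Definition _ := SubChoice.on ns_sub.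
HB.instance Definition _ :=
  SubChoice_isSubGroup.Build H (fun x => x \in N) ns_sub (ns_group N).

Lemma ns1 : 1 \in N. Proof. by case: (ns_group N). Qed.

Lemma nsV x : x \in N -> x^-1 \in N.
Proof. exact: (group_closedV (ns_group N)). Qed.

Lemma nsM x y : x \in N -> y \in N -> x * y \in N.
Proof. exact: (group_closedM (ns_group N)). Qed.

Definition ns_rel : rel H := fun x y => x^-1 * y \in N.

Lemma ns_rel_refl : reflexive ns_rel.
Proof. by move=> x; rewrite /ns_rel mulVg ns1. Qed.

Lemma ns_rel_sym : symmetric ns_rel.
Proof.
have S x y : ns_rel x y -> ns_rel y x.
  by move=> /nsV; rewrite invgM invgK.
by move=> x y; apply/idP/idP; apply: S.
Qed.

Lemma ns_rel_trans : transitive ns_rel.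
Proof. by move=> y x z Nxy /(nsM Nxy); rewrite /ns_rel mulgA mulgK. Qed.

Canonical ns_equiv := EquivRel ns_rel ns_rel_refl ns_rel_sym ns_rel_trans.

Definition ns_quot : Type := {eq_quot ns_equiv}.

HB.instance Definition _ := Choice.on ns_quot.
HB.instance Definition _ := EqQuotient.on ns_quot.

Definition ns_quot_one : ns_quot := \pi_ns_quot 1.
Definition ns_quot_inv (a : ns_quot) : ns_quot := \pi_ns_quot (repr a)^-1.
Definition ns_quot_mul (a b : ns_quot) : ns_quot :=
  \pi_ns_quot (repr a * repr b).

Lemma ns_piP (x y : H) :
  reflect (\pi_ns_quot x = \pi_ns_quot y) (x^-1 * y \in N).
Proof. exact: (@eqmodP H ns_equiv x y). Qed.

Lemma ns_repr (x : H) : x^-1 * repr (\pi_ns_quot x) \in N.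
Proof. by apply/ns_piP; rewrite reprK. Qed.

Lemma ns_quot_piM (x y : H) :
  ns_quot_mul (\pi_ns_quot x) (\pi_ns_quot y) = \pi_ns_quot (x * y).
Proof.
apply/esym/ns_piP; set a := repr _; set b := repr _.
have -> : (x * y)^-1 * (a * b) = (x^-1 * a) ^ y * (y^-1 * b).
  by rewrite /conjg invgM !mulgA mulgK.
by apply: nsM; [apply: ns_normal|]; apply: ns_repr.
Qed.

Lemma ns_quot_piV (x : H) :
  ns_quot_inv (\pi_ns_quot x) = \pi_ns_quot x^-1.
Proof.
apply/ns_piP; rewrite invgK; set a := repr _.
have -> : a * x^-1 = (x^-1 * a) ^ x^-1.
  by rewrite /conjg invgK !mulgA mulgV mul1g.
by apply: ns_normal; apply: ns_repr.
Qed.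

Lemma ns_quot_mulA : associative ns_quot_mul.
Proof.
elim/quotW=> x; elim/quotW=> y; elim/quotW=> z.
by rewrite (ns_quot_piM y z) (ns_quot_piM x y) (ns_quot_piM x) mulgA ns_quot_piM.
Qed.

Lemma ns_quot_mul1 : left_id ns_quot_one ns_quot_mul.
Proof. by elim/quotW=> x; rewrite ns_quot_piM mul1g. Qed.

Lemma ns_quot_mulr1 : right_id ns_quot_one ns_quot_mul.
Proof. by elim/quotW=> x; rewrite ns_quot_piM mulg1. Qed.

Lemma ns_quot_mulV : left_inverse ns_quot_one ns_quot_inv ns_quot_mul.
Proof. by elim/quotW=> x; rewrite ns_quot_piV ns_quot_piM mulVg. Qed.

Lemma ns_quot_mulrV : right_inverse ns_quot_one ns_quot_inv ns_quot_mul.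
Proof. by elim/quotW=> x; rewrite ns_quot_piV ns_quot_piM mulgV. Qed.

HB.instance Definition _ := isGroup.Build ns_quot
  ns_quot_mulA ns_quot_mul1 ns_quot_mulr1 ns_quot_mulV ns_quot_mulrV.

End SubgroupAndQuotient.

Definition product_variety (M N : group_class) : group_class :=
  fun H => exists K : normal_subgroup H, M (ns_sub K) /\ N (ns_quot K).

(* The only subgroup of G containing all the x i is G itself. As for normal
   subgroups above, subsets are boolean predicates, which classically is no
   restriction. *)
Definition k_generated (k : nat) (G : groupType) : Prop :=
  exists x : 'I_k -> G,
    forall S : {pred G}, group_closed S -> (forall i, x i \in S) ->
      forall g : G, g \in S.

Definition embeds (G H : groupType) : Prop :=
  exists f : {multiplicative G -> H}, injective f.

Definition has_derived_length (l : nat) (G : finGroupType) : Prop :=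
  [set: G]^`(l) = 1 /\ (forall k, k < l -> [set: G]^`(k) <> 1).

(* Main.v *)
From HB Require Import structures.
Require Import Defs.
From mathcomp Require Import all_boot all_fingroup all_solvable zmodp.
From mathcomp Require boolp.
From mathcomp Require Import zify.

(** The group H is found inside the wreath product of G by the abelian group
    A = Z_s x Z_s x Z_s, where s = e ^ (m+1): the three standard generators of
    A are three of the generators of H, and the fourth is one function F from A
    to G that encodes all the generators x_0, ..., x_(m-1) of G.

    Write a point of A as (b, i, j).  On the slice {b} x Z_s x Z_s the function
    F only takes powers of x_b, namely x_b ^ (d_b(i) d_(m-b)(j)), where
    d_k(i) = i div e^k; modulo e, which is all that matters for the exponent,
    this is the e-adic digit of i of index k.  Take differences of F along
    e^k in the direction of i and along e^(m-k) in the direction of j.  Adding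
    e^k to i leaves d_b(i) unchanged modulo e when b < k, and increases it by 1
    when b = k; for b > k carries occur, but then m-b < m-k and the difference
    in the direction of j vanishes instead.  So the double difference is x_k on
    the slice b = k and 1 elsewhere ([double_difference]).  In the wreath
    product, differences are commutators with elements of A; hence, after
    translating the slice k to the slice 0, the function that is x_k on the
    slice 0 and 1 elsewhere is a commutator in H ([slice0_commutator]).
    Because one and the same slice serves every k, sending g to the function
    equal to g on the slice 0 and to 1 elsewhere is an embedding of G into H,
    even into the derived subgroup of H.  That G is not commutative does no
    harm, because on each slice F takes its values in a cyclic group.

    The functions in H form a normal subgroup K with H / K abelian of exponent
    s, and the evaluations at the points of A separate the points of K and are
    homomorphisms to G.  So K satisfies all the laws of G, in particular it has
    exponent e and H has exponent e * s ([product_wreath], [wreath_exponent]).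

    For a finite group G any multiple of its order can serve as e, with all
    elements of G as generators.  If G has derived length l, then that of H is
    at most l+1 because of K, and at least l+1 because H' contains G; for l = 0
    this still needs H to be nontrivial, which is why e is then chosen greater
    than 1 ([wreath_derived_length]).  For a p-group, e is a power of p, and so
    is the exponent of H. *)

Set Implicit Arguments.
Unset Strict Implicit.
Unset Printing Implicit Defensive.

(** * The subgroup generated by a family, as a group type *)

Section GeneratedSubgroup.

Local Open Scope group_scope.

(** Membership must be boolean for the elements to form a subtype, while
    in an infinite group it is not decidable: [asbool] makes the choice. *)
Definition generated_pred (W : groupType) k (g : 'I_k -> W) : pred W :=
  fun w => boolp.asbool (forall S : {pred W},
    group_closed S -> (forall i, g i \in S) -> w \in S).

Lemma generated_predP (W : groupType) k (g : 'I_k -> W) (w : W) :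
  reflect (forall S : {pred W}, group_closed S -> (forall i, g i \in S) ->
             w \in S)
          (w \in generated_pred g).
Proof. exact: boolp.asboolP. Qed.

Lemma generated_closed (W : groupType) k (g : 'I_k -> W) :
  group_closed (generated_pred g).
Proof.
split=> [|u v /generated_predP Hu /generated_predP Hv].
  by apply/generated_predP => S [].
apply/generated_predP => S clS gS.
by case: (clS) => _; apply; [apply: Hu | apply: Hv].
Qed.

Lemma mem_generated (W : groupType) k (g : 'I_k -> W) i :
  g i \in generated_pred g.
Proof. by apply/generated_predP. Qed.

Definition generated (W : groupType) k (g : 'I_k -> W) : Type :=
  {w : W | w \in generated_pred g}.

HB.instance Definition _ (W : groupType) k (g : 'I_k -> W) :=
  SubChoice.on (generated g).
HB.instance Definition _ (W : groupType) k (g : 'I_k -> W) :=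
  SubChoice_isSubGroup.Build W (fun w => w \in generated_pred g) (generated g)
    (generated_closed g).
HB.instance Definition _ (W : finGroupType) k (g : 'I_k -> W) :=
  [Finite of generated g by <:].

Lemma generated_k_generated (W : groupType) k (g : 'I_k -> W) :
  k_generated k (generated g).
Proof.
exists (fun i => Sub (g i) (mem_generated g i)) => S clS gS h.
(* The image of S in W, which is again closed and contains all the g i. *)
pose T : {pred W} :=
  [pred w | if insub w is Some u then (u : generated g) \in S else false].
have TP (u : generated g) : (val u \in T) = (u \in S).
  by rewrite inE valK.
rewrite -TP; have /generated_predP := valP h; apply; last first.
  by move=> i; rewrite -(SubK (generated g) (mem_generated g i)) TP.
split=> [|u v].
  by rewrite (_ : 1 = val (1 : generated g)) ?TP ?gmulf1 //; case: clS.
rewrite !inE; case: insubP => // u' _ <-; case: insubP => // v' _ <- Su Sv.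
have -> : val u' * (val v')^-1 = val (u' * v'^-1) by rewrite gmulfF.
by rewrite valK; case: clS => _; apply.
Qed.

End GeneratedSubgroup.

(** * Wreath products by a finite group *)

Section Wreath.

Local Open Scope group_scope.

Definition wreath (A : finGroupType) (G : groupType) : Type :=
  ({ffun A -> G} * A)%type.

Variables (A : finGroupType) (G : groupType).
Implicit Types (f g h : {ffun A -> G}) (a z : A) (u v w : wreath A G).

Lemma ffun_mulE f g z : (f * g) z = f z * g z. Proof. exact: ffunE. Qed.
Lemma ffun_oneE z : (1 : {ffun A -> G}) z = 1. Proof. exact: ffunE. Qed.
Lemma ffun_invE f z : f^-1 z = (f z)^-1. Proof. exact: ffunE. Qed.

Definition translate a f : {ffun A -> G} := [ffun z => f (a * z)].

Lemma translateE a f z : translate a f z = f (a * z). Proof. exact: ffunE. Qed.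

Definition pointwiseE := (ffun_mulE, ffun_oneE, ffun_invE, translateE).

(** The translation by the inverse of u.2 makes conjugation by a turn f into
    z |-> f (a z), without an inverse ([base_conj_top]). *)
Definition wreath_one : wreath A G := (1, 1).
Definition wreath_mul u v : wreath A G :=
  (u.1 * translate u.2^-1 v.1, u.2 * v.2).
Definition wreath_inv u : wreath A G := (translate u.2 u.1^-1, u.2^-1).

Lemma wreath_mulA : associative wreath_mul.
Proof.
case=> f a [g b] [h c]; congr (_, _); last exact: mulgA.
by apply/ffunP=> z; rewrite !pointwiseE /= invgM !mulgA.
Qed.

Lemma wreath_mul1 : left_id wreath_one wreath_mul.
Proof.
case=> f a; congr (_, _); last exact: mul1g.
by apply/ffunP=> z; rewrite !pointwiseE /= invg1 !mul1g.
Qed.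

Lemma wreath_mulr1 : right_id wreath_one wreath_mul.
Proof.
case=> f a; congr (_, _); last exact: mulg1.
by apply/ffunP=> z; rewrite !pointwiseE mulg1.
Qed.

Lemma wreath_mulV : left_inverse wreath_one wreath_inv wreath_mul.
Proof.
case=> f a; congr (_, _); last exact: mulVg.
by apply/ffunP=> z; rewrite !pointwiseE invgK mulVg.
Qed.

Lemma wreath_mulrV : right_inverse wreath_one wreath_inv wreath_mul.
Proof.
case=> f a; congr (_, _); last exact: mulgV.
by apply/ffunP=> z; rewrite !pointwiseE /= mulKVg mulgV.
Qed.

HB.instance Definition _ := Choice.on (wreath A G).
HB.instance Definition _ := isGroup.Build (wreath A G)
  wreath_mulA wreath_mul1 wreath_mulr1 wreath_mulV wreath_mulrV.

Definition base f : wreath A G := (f, 1).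
Definition top a : wreath A G := (1, a).

Lemma baseM f g : base f * base g = base (f * g).
Proof.
congr (_, _); last exact: mulg1.
by apply/ffunP=> z; rewrite !pointwiseE /= invg1 mul1g.
Qed.

Lemma baseV f : (base f)^-1 = base f^-1.
Proof. by apply: mulg1_eq; rewrite baseM mulgV. Qed.

Lemma topM a b : top a * top b = top (a * b).
Proof. by congr (_, _); apply/ffunP=> z; rewrite !pointwiseE mulg1. Qed.

Lemma topX a n : top a ^+ n = top (a ^+ n).
Proof. by elim: n => // n IHn; rewrite !expgS IHn topM. Qed.

Lemma base_conj_top f a : base f ^ top a = base (translate a f).
Proof.
apply: (canLR (mulKg _)); congr (_, _); last by rewrite /= mul1g mulg1.
by apply/ffunP=> z; rewrite !pointwiseE /= mul1g mulg1 mulKVg.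
Qed.

(** The multiplicative analogue of a finite difference in the direction a. *)
Definition difference a f : {ffun A -> G} := f^-1 * translate a f.

Lemma base_comm_top f a : [~ base f, top a] = base (difference a f).
Proof. by rewrite commgEl base_conj_top baseV baseM. Qed.

Lemma wreath_fstM u v z : u.2 = 1 -> (u * v).1 z = u.1 z * v.1 z.
Proof. by move=> u1; rewrite !pointwiseE u1 invg1 mul1g. Qed.

End Wreath.

HB.instance Definition _ (A G : finGroupType) := Finite.on (wreath A G).

(** * Digits in base e *)

Section Digits.

Variables (e m : nat).
Hypothesis e_gt0 : 0 < e.

(** Reduction modulo e ^ m.+1 changes the quotient by e ^ i by a multiple of e,
    which digits do not see. *)
Lemma digit_wrap i j d : i <= m ->
  (((j + d) %% e ^ m.+1) %/ e ^ i) = (j + d) %/ e ^ i %[mod e].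
Proof.
move=> le_im; rewrite {2}(divn_eq (j + d) (e ^ m.+1)).
have -> : e ^ m.+1 = e ^ (m - i) * e * e ^ i.
  by rewrite -expnSr -expnD; congr (_ ^ _); lia.
by rewrite mulnA divnMDl ?expn_gt0 ?e_gt0 // mulnA modnMDl.
Qed.

Lemma digit_shift i j : i <= m ->
  (((j + e ^ i) %% e ^ m.+1) %/ e ^ i) = j %/ e ^ i + 1 %[mod e].
Proof.
by move=> le_im; rewrite digit_wrap // divnDr ?dvdnn // divnn expn_gt0 e_gt0.
Qed.

Lemma digit_stable i k j : i <= m -> i < k ->
  (((j + e ^ k) %% e ^ m.+1) %/ e ^ i) = j %/ e ^ i %[mod e].
Proof.
move=> le_im lt_ik; rewrite digit_wrap //.
have -> : e ^ k = e ^ (k - i.+1) * e * e ^ i.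
  by rewrite -expnSr -expnD; congr (_ ^ _); lia.
by rewrite addnC divnMDl ?expn_gt0 ?e_gt0 // modnMDl.
Qed.

End Digits.

(** * Four elements of the wreath product and the copy of G they generate *)

Section Embedding.

Local Open Scope group_scope.

Lemma expg_eqmod (G : groupType) (g : G) (e a b : nat) :
  g ^+ e = 1 -> a = b %[mod e] -> g ^+ a = g ^+ b.
Proof.
move=> ge ab; rewrite (divn_eq a e) (divn_eq b e) ab !expgnDr.
by rewrite ![(_ * e)%N]mulnC !expgnA ge !expg1n.
Qed.

Variables (G : groupType) (m e : nat) (x : nat -> G).
Hypothesis e_gt0 : 0 < e.
Hypothesis Ge : has_exponent e G.

(* 'I_n.+1 carries a group structure for every n, including the case e = 1. *)
Let n := (e ^ m.+1).-1.
Notation Z := 'I_n.+1.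

Definition torus : finGroupType := (Z * Z * Z)%type.
Implicit Types z : torus.

Definition shift (b i j : nat) : torus := (inZp b, inZp i, inZp j).

Lemma torus_order : n.+1 = (e ^ m.+1)%N.
Proof. by rewrite prednK // expn_gt0 e_gt0. Qed.

Lemma torusC : commutative (@mul torus).
Proof. by move=> [[a b] c] [[a' b'] c']; congr (_, _, _); apply: Zp_mulgC. Qed.

Lemma shift_mul b i j b' i' j' :
  shift b i j * shift b' i' j' = shift (b + b') (i + i') (j + j').
Proof. by congr (_, _, _); apply: val_inj; rewrite /= modnDm. Qed.

Lemma shiftX b i j k : shift b i j ^+ k = shift (b * k) (i * k) (j * k).
Proof.
elim: k => [|k IHk].
  by rewrite !muln0; congr (_, _, _); apply: val_inj; rewrite /= mod0n.
by rewrite expgSr IHk shift_mul -!mulnSr.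
Qed.

Lemma torus_exponent z : z ^+ (e ^ m.+1) = 1.
Proof.
have -> : z = shift z.1.1 z.1.2 z.2.
  by case: z => [[a b] c]; rewrite /shift !valZpK.
rewrite shiftX -torus_order.
by congr (_, _, _); apply: val_inj; rewrite /= modnMl.
Qed.

(** The single function that encodes all the x_b.  The second digit index
    m - b decreases with b, so that of two distinct slices each one has the
    larger index in one of the two directions. *)
Definition digit_fun : {ffun torus -> G} :=
  [ffun z : torus =>
     x z.1.1 ^+ ((z.1.2 %/ e ^ z.1.1) * (z.2 %/ e ^ (m - z.1.1)))].

Definition slice k (g : G) : {ffun torus -> G} :=
  [ffun z : torus => if z.1.1 == k :> nat then g else 1].

(** Two opposite differences isolate one slice: the one along e ^ k kills the
    slices below k, the one along e ^ (m - k) those above k. *)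
Lemma double_difference k : k < m ->
  difference (shift 0 0 (e ^ (m - k)))
      (difference (shift 0 (e ^ k) 0) digit_fun)
    = slice k (x k).
Proof.
move=> lt_km; apply/ffunP=> -[[b i] j].
have stepV : shift 0 0 (e ^ (m - k)) * (b, i, j)
    = (b, i, inZp (j + e ^ (m - k))).
  congr (_, _, _); apply: val_inj => /=; first 2 last.
  - by rewrite modnDml addnC.
  - by rewrite mod0n add0n modn_small.
  by rewrite mod0n add0n modn_small.
have stepU j' : shift 0 (e ^ k) 0 * (b, i, j') = (b, inZp (i + e ^ k), j').
  congr (_, _, _); apply: val_inj => /=.
  - by rewrite mod0n add0n modn_small.
  - by rewrite modnDml addnC.
  by rewrite mod0n add0n modn_small.
rewrite !pointwiseE stepV stepU stepU !ffunE /= -/n.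
set i' := ((i + _) %% _)%N; set j' := ((j + _) %% _)%N.
have i'E : i' = ((i + e ^ k) %% e ^ m.+1)%N by rewrite -torus_order.
have j'E : j' = ((j + e ^ (m - k)) %% e ^ m.+1)%N by rewrite -torus_order.
set y := x b.
have eq_exp a a' c c' : a = a' %[mod e] -> c = c' %[mod e] ->
    y ^+ (a * c) = y ^+ (a' * c').
  by move=> aa cc; apply: (expg_eqmod (Ge (x b))); rewrite -modnMm aa cc modnMm.
have [lt_bk|lt_kb|eq_bk] := ltngtP b k.
(* b < k: the inner difference is already trivial. *)
- rewrite (eq_exp (i' %/ e ^ b)%N (i %/ e ^ b)%N _ _ _ erefl); last first.
    by rewrite i'E digit_stable //; lia.
  rewrite (eq_exp (i' %/ e ^ b)%N (i %/ e ^ b)%N _ _ _ erefl).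
    by rewrite !mulVg.
  by rewrite i'E digit_stable //; lia.
(* b > k: carries make the inner difference unknown, but F is unchanged in the
   direction of j. *)
- have j'j : (j' %/ e ^ (m - b) = j %/ e ^ (m - b) %[mod e])%N.
    by rewrite j'E digit_stable // ?leq_subr //; lia.
  by rewrite !(eq_exp _ _ _ _ erefl j'j) mulVg.
(* b = k: both digits increase by 1, and the double difference of d d' is
   (d + 1) (d' + 1) - d (d' + 1) - (d + 1) d' + d d' = 1. *)
have i'i : i' %/ e ^ b = i %/ e ^ b + 1 %[mod e].
  by rewrite i'E -eq_bk digit_shift // eq_bk ltnW.
have j'j : j' %/ e ^ (m - b) = j %/ e ^ (m - b) + 1 %[mod e].
  by rewrite j'E -eq_bk digit_shift // leq_subr.
rewrite (eq_exp _ _ _ _ i'i j'j)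
  (eq_exp _ _ _ _ i'i erefl) (eq_exp _ _ _ _ erefl j'j).
by rewrite !mulnDl !mul1n !expgnDr !mulKg expg1 /y eq_bk.
Qed.

Lemma translate_slice k g : k <= n ->
  translate (shift k 0 0) (slice k g) = slice 0 g.
Proof.
move=> le_kn; apply/ffunP=> -[[b i] j]; rewrite !ffunE /= modnDml.
congr (if _ then _ else _); have [lt_kbn|le_nkb] := ltnP (k + b) n.+1.
  by rewrite modn_small // -[X in _ == X]addn0 eqn_add2l.
have -> : (k + b = (k + b - n.+1) + n.+1)%N by rewrite subnK.
have lt_bn := ltn_ord b; rewrite modnDr modn_small; lia.
Qed.

Definition wreath_gens (i : 'I_4) : wreath torus G :=
  nth 1 [:: base digit_fun; top G (shift 1 0 0);
            top G (shift 0 1 0); top G (shift 0 0 1)] i.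

Local Notation H := (generated wreath_gens).

Definition slice0 (g : G) : wreath torus G := base (slice 0 g).

Lemma slice0M : {morph slice0 : g h / g * h}.
Proof.
move=> g h; rewrite /slice0 baseM; congr base; apply/ffunP=> z.
by rewrite !pointwiseE !ffunE; case: ifP; rewrite ?mulg1.
Qed.

Lemma slice01 : slice0 1 = 1.
Proof. by congr (_, _); apply/ffunP=> z; rewrite !ffunE; case: ifP. Qed.

Lemma slice0_inj : injective slice0.
Proof. by move=> g h [] /ffunP /(_ (1 : torus)); rewrite !ffunE. Qed.

(** The double difference of F is an iterated commutator of F with powers of two
    generators, and conjugating by a power of the third moves the slice k to the
    slice 0.  That this element is a commutator in H, and not merely an element
    of H, is what later forces the derived length up. *)
Lemma slice0_commutator k : k < m ->
  exists u v : H, val [~ u, v] = slice0 (x k).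
Proof.
move=> lt_km.
have [xk1|xk_neq1] := eqVneq (x k) 1.
  by exists 1, 1; rewrite commg1 xk1 slice01 gmulf1.
(* For e = 1 there may be fewer than m slices, but then G is trivial. *)
have le_kn : k <= n.
  have e_gt1 : 1 < e.
    rewrite ltn_neqAle e_gt0 andbT; apply: contra_neq xk_neq1 => e1.
    by rewrite -(Ge (x k)) -e1.
  rewrite -ltnS torus_order (leq_trans lt_km) //.
  by rewrite (leq_trans (leqnSn m)) // ltnW // ltn_expl.
pose g i : H := Sub (wreath_gens i) (mem_generated wreath_gens i).
have valR (u v : H) : val [~ u, v] = [~ val u, val v] by rewrite gmulfR.
have valJ (u v : H) : val (u ^ v) = val u ^ val v by rewrite gmulfJ.
pose F := g (inord 0); pose T := g (inord 1) ^+ k.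
pose U := g (inord 2) ^+ (e ^ k); pose V := g (inord 3) ^+ (e ^ (m - k)).
have vF : val F = base digit_fun by rewrite SubK /wreath_gens inordK.
have vT : val T = top G (shift k 0 0).
  by rewrite gmulfXn /= /wreath_gens inordK //= topX shiftX mul1n !mul0n.
have vU : val U = top G (shift 0 (e ^ k) 0).
  by rewrite gmulfXn /= /wreath_gens inordK //= topX shiftX mul1n !mul0n.
have vV : val V = top G (shift 0 0 (e ^ (m - k))).
  by rewrite gmulfXn /= /wreath_gens inordK //= topX shiftX mul1n !mul0n.
exists ([~ F, U] ^ T), (V ^ T); rewrite -conjRg valJ !valR vF vT vU vV.
by rewrite !base_comm_top base_conj_top double_difference // translate_slice.
Qed.

Hypothesis x_gen : forall S : {pred G}, group_closed S ->
  (forall k, k < m -> x k \in S) -> forall g, g \in S.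

Lemma slice0_generated g : slice0 g \in generated_pred wreath_gens.
Proof.
pose S : {pred G} := [pred h | slice0 h \in generated_pred wreath_gens].
have [gen1 genF] := generated_closed wreath_gens.
suff: g \in S by [].
apply: x_gen => [|k lt_km]; last first.
  have [u [v uv]] := slice0_commutator lt_km.
  by rewrite inE -uv (valP [~ u, v]).
have slice0V h : slice0 h^-1 = (slice0 h)^-1.
  by apply/esym/mulg1_eq; rewrite -slice0M mulgV slice01.
split=> [|h h' Sh Sh']; rewrite !inE ?slice01 // slice0M slice0V.
exact: genF.
Qed.

Definition embedding (g : G) : H := Sub (slice0 g) (slice0_generated g).

Lemma embeddingM : {morph embedding : g h / g * h}.
Proof. by move=> g h; apply: val_inj; rewrite /= slice0M. Qed.

Lemma embedding_inj : injective embedding.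
Proof. by move=> g h /(congr1 val) /= /slice0_inj. Qed.

Lemma embedding_embeds : embeds G H.
Proof.
pose f : {multiplicative G -> H} :=
  HB.pack embedding (isMultiplicative.Build G H embedding embeddingM).
by exists f; apply: embedding_inj.
Qed.

Lemma embedding_commutator k : k < m ->
  exists u v : H, embedding (x k) = [~ u, v].
Proof.
by move=> /slice0_commutator[u [v uv]]; exists u, v; apply: val_inj.
Qed.

End Embedding.

(** * Varieties, quotients and derived lengths *)

Section VarietyClosure.

Local Open Scope group_scope.

(** H embeds in a power of G, and laws pass to powers and subgroups. *)
Lemma variety_separated (M : group_class) (G H : groupType) (I : Type)
    (phi : I -> H -> G) :
  is_variety M -> M G -> (forall i, {morph phi i : u v / u * v}) ->
  (forall u, (forall i, phi i u = 1) -> u = 1) -> M H.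
Proof.
move=> [W MW] /MW lawG phiM sep; apply/MW => w Ww y; apply: sep => i.
have phi1 : phi i 1 = 1 by apply: (@mulgI _ (phi i 1)); rewrite -phiM !mulg1.
have phiV u : phi i u^-1 = (phi i u)^-1.
  by apply/esym/mulg1_eq; rewrite -phiM mulgV.
rewrite -(lawG w Ww (phi i \o y)); elim: w {Ww} => //= [u IHu v IHv|u IHu].
  by rewrite phiM IHu IHv.
by rewrite phiV IHu.
Qed.

Lemma ns_quot_abelian (H : groupType) (N : normal_subgroup H) :
  (forall u v : H, (u * v)^-1 * (v * u) \in N) -> abelian_variety (ns_quot N).
Proof.
move=> cN; elim/quotW=> u; elim/quotW=> v.
rewrite -[LHS]/(ns_quot_mul _ _) -[RHS]/(ns_quot_mul _ _) !ns_quot_piM.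
exact/ns_piP.
Qed.

Lemma ns_quot_exponent (H : groupType) (N : normal_subgroup H) s :
  (forall u : H, u ^+ s \in N) -> has_exponent s (ns_quot N).
Proof.
move=> eN; elim/quotW=> u.
have piX k : (\pi_(ns_quot N) u ^+ k = \pi_(ns_quot N) (u ^+ k)%g)%qT.
  elim: k => // k IHk; rewrite !expgS IHk.
  by rewrite -[LHS]/(ns_quot_mul _ _) ns_quot_piM.
by rewrite piX; apply/esym/ns_piP; rewrite invg1 mul1g.
Qed.

End VarietyClosure.

Section DerivedLength.

Local Open Scope group_scope.

Lemma der_addn (gT : finGroupType) (H : {group gT}) i j :
  H^`(i + j) = H^`(i)^`(j).
Proof. by elim: j => [|j IHj]; rewrite ?addn0 // addnS !dergSn IHj. Qed.

(** H' lies in K, which embeds in a power of G and so has derived length at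
    most l; and H' contains a copy of G, so its derived length is at least l.
    For l = 0 it is the nontriviality of H that makes its derived length 1. *)
Lemma derived_length_succ (G H : finGroupType) (f : G -> H) (I : Type)
    (phi : I -> H -> G) (K : {group H}) l :
  {morph f : g h / g * h} -> injective f ->
  (forall g, f g \in [set: H]^`(1)) ->
  [set: H]^`(1) \subset K ->
  (forall i, {in K &, {morph phi i : u v / u * v}}) ->
  (forall u, u \in K -> (forall i, phi i u = 1) -> u = 1) ->
  [set: H] <> 1 -> has_derived_length l G -> has_derived_length l.+1 H.
Proof.
move=> fM f_inj f_der sHK phiM sep ntH [Gl1 Gk1].
split=> [|k lt_kl].
  apply/trivgP; have: [set: H]^`(l.+1) \subset K^`(l).
    by rewrite -add1n der_addn dergS.
  move=> /subset_trans; apply; apply/subsetP => u Ku; apply/set1gP.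
  have K_u : u \in K by apply: subsetP Ku; apply: der_sub.
  apply: sep => // i; pose phi_i := Morphism (phiM i).
  apply/set1gP; rewrite -[phi i u]/(phi_i u).
  have : phi_i u \in phi_i @* K^`(l) by apply: mem_morphim.
  rewrite morphim_der // => /(subsetP (dergS l (subsetT _))).
  by rewrite Gl1.
case: k lt_kl => [|k] lt_kl // Hk1.
pose fm := Morphism (in2W fM : {in [set: G] &, _}).
case: (Gk1 k lt_kl); apply/trivgP/subsetP => g Gg; apply/set1gP.
apply: f_inj; rewrite -[f 1]/(fm 1) morph1; apply/set1gP.
rewrite -Hk1 -add1n der_addn.
have: fm g \in fm @* [set: G]^`(k) by apply: mem_morphim; rewrite ?inE.
rewrite morphim_der //; apply/subsetP/dergS/subsetP => _ /morphimP[h _ _ ->].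
exact: f_der.
Qed.

End DerivedLength.

(** * The subgroup generated by the four elements *)

Section FourGenerators.

Local Open Scope group_scope.

Variables (G : groupType) (m e : nat) (x : nat -> G).
Local Notation H := (generated (wreath_gens m e x)).

Definition coordinate (z : torus m e) (u : H) : G := (val u).1 z.

Definition in_base : pred H := [pred u | (val u).2 == 1].

Lemma in_base_sndM (u v : H) : (val (u * v)).2 = (val u).2 * (val v).2.
Proof. by []. Qed.

Lemma in_base_sndV (u : H) : (val u^-1).2 = (val u).2^-1.
Proof. by []. Qed.

Lemma in_base_group : group_closed in_base.
Proof.
split=> [|u v]; first by rewrite !inE.
by rewrite !inE in_base_sndM => /eqP-> /eqP v1; rewrite mul1g /= v1 invg1.
Qed.

Lemma in_base_normal (u v : H) : u \in in_base -> u ^ v \in in_base.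
Proof.
by rewrite !inE !in_base_sndM => /eqP->; rewrite mul1g /= mulVg.
Qed.

Definition base_subgroup : normal_subgroup H :=
  NormalSubgroup in_base_group in_base_normal.

(** Evaluation is multiplicative only on functions: in general the second factor
    is translated by the A-component of the first. *)
Lemma coordinateM z : {in in_base &, {morph coordinate z : u v / u * v}}.
Proof. by move=> u v /eqP u1 _; apply: wreath_fstM. Qed.

Lemma coordinate_sep (u : H) :
  u \in in_base -> (forall z, coordinate z u = 1) -> u = 1.
Proof.
move=> /eqP u2 u1; apply: val_inj; rewrite [val u]surjective_pairing u2.
by congr (_, _); apply/ffunP => z; rewrite ffun_oneE; apply: u1.
Qed.

Lemma base_subgroup_variety (M : group_class) :
  is_variety M -> M G -> M (ns_sub base_subgroup).
Proof.
move=> vM MG.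
apply: (variety_separated (phi := fun z (u : ns_sub base_subgroup) =>
  coordinate z (val u)) vM MG) => [z u v|u u1].
  by apply: coordinateM; apply: (valP (_ : ns_sub base_subgroup)).
by apply: val_inj; apply: coordinate_sep u1; apply: valP.
Qed.

Hypothesis e_gt0 : 0 < e.

Lemma exp_in_base (u : H) : u ^+ (e ^ m.+1) \in in_base.
Proof.
have val2X k : (val (u ^+ k)).2 = (val u).2 ^+ k.
  by elim: k => // k IHk; rewrite !expgS in_base_sndM IHk.
by rewrite inE val2X torus_exponent.
Qed.

Lemma in_base_comm (u v : H) : (u * v)^-1 * (v * u) \in in_base.
Proof.
rewrite inE in_base_sndM in_base_sndV !in_base_sndM.
by rewrite [(val v).2 * _]torusC mulVg.
Qed.

Lemma base_quotient_variety :
  abelian_exp_variety (e ^ m.+1) (ns_quot base_subgroup).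
Proof.
split; first by apply: ns_quot_abelian => u v; apply: in_base_comm.
by apply: ns_quot_exponent => u; apply: exp_in_base.
Qed.

Lemma product_wreath (M : group_class) : is_variety M -> M G ->
  product_variety M (abelian_exp_variety (e ^ m.+1)) H.
Proof.
move=> vM MG; exists base_subgroup; split; first exact: base_subgroup_variety.
exact: base_quotient_variety.
Qed.

Hypothesis Ge : has_exponent e G.

(** The power by s falls into the functions, which have exponent e. *)
Lemma wreath_exponent : has_exponent (e ^ m.+2) H.
Proof.
move=> u; rewrite expnSr expgnA; set v := u ^+ _.
have v_base : v \in in_base := exp_in_base u.
have vX_base k : v ^+ k \in in_base.
  elim: k => [|k IHk]; first by case: in_base_group.
  by rewrite expgS (group_closedM in_base_group).
apply: coordinate_sep => // z.
have coordX k : coordinate z (v ^+ k) = coordinate z v ^+ k.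
  elim: k => [|k IHk]; first by rewrite /coordinate /= ffun_oneE.
  by rewrite !expgS coordinateM // IHk.
by rewrite coordX Ge.
Qed.

Lemma wreath_nontrivial : 1 < e -> exists u : H, u <> 1.
Proof.
move=> e_gt1.
exists (Sub (wreath_gens m e x (inord 1)) (mem_generated _ _)).
move=> /(congr1 (fun u : H => nat_of_ord (val u).2.1.1)).
rewrite SubK /wreath_gens inordK //= modn_small //.
by rewrite prednK ?expn_gt0 ?e_gt0 // -[1%N](expn0 e) ltn_exp2l.
Qed.

End FourGenerators.

(** * The finite case *)

Section FiniteFourGenerators.

Local Open Scope group_scope.

Variables (G : finGroupType) (m e : nat) (x : nat -> G).
Hypotheses (e_gt0 : 0 < e) (Ge : has_exponent e G).
Hypothesis x_gen : forall S : {pred G}, group_closed S ->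
  (forall k, k < m -> x k \in S) -> forall g, g \in S.

Definition finite_wreath_subgroup : finGroupType :=
  generated (wreath_gens m e x).
Local Notation H := finite_wreath_subgroup.

Lemma embedding_der1 g : (embedding e_gt0 Ge x_gen g : H) \in [set: H]^`(1).
Proof.
pose f : G -> H := embedding e_gt0 Ge x_gen.
have fM : {morph f : g h / g * h} := embeddingM e_gt0 Ge x_gen.
have f1 : f 1 = 1 by apply: (@mulgI _ (f 1)); rewrite -fM !mulg1.
have fV h : f h^-1 = (f h)^-1 by apply/esym/mulg1_eq; rewrite -fM mulgV.
pose S : {pred G} := [pred h | f h \in [set: H]^`(1)].
suff: g \in S by [].
apply: x_gen => [|k lt_km]; last first.
  have [u [v uv]] := embedding_commutator e_gt0 Ge x_gen lt_km.
  by rewrite inE /f uv derg1 mem_commg ?inE.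
split=> [|h h']; rewrite !inE ?f1 ?group1 // fM fV => Sh Sh'.
by rewrite groupM ?groupV.
Qed.

Lemma wreath_derived_length l : 1 < e ->
  has_derived_length l G -> has_derived_length l.+1 H.
Proof.
move=> e_gt1; have base_group : group_set [set u : H | in_base u].
  apply/group_setP; split=> [|u v]; rewrite ?inE //.
  exact: (group_closedM (in_base_group m e x)).
apply: (derived_length_succ (K := Group base_group)
  (embeddingM e_gt0 Ge x_gen) (@embedding_inj _ _ _ _ e_gt0 Ge x_gen)
  embedding_der1 (phi := @coordinate G m e x)) => [|z u v|u|H1].
- rewrite derg1 gen_subG; apply/subsetP=> _ /imset2P[u v _ _ ->].
  have -> : [~ u, v] = (v * u)^-1 * (u * v) by rewrite invgM -mulgA.
  by rewrite inE; apply: in_base_comm.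
- by rewrite !inE => *; apply: coordinateM.
- by rewrite inE; apply: coordinate_sep.
have [u u_neq1] := wreath_nontrivial m x e_gt0 e_gt1.
by case: u_neq1; apply/set1gP; rewrite -H1 inE.
Qed.

End FiniteFourGenerators.

Theorem corollary6 :
  (* (1) *)
  (forall (M : group_class) (G : groupType) (m e : nat),
      is_variety M -> M G -> k_generated m G ->
      0 < e -> has_exponent e G ->
      exists H : groupType,
        [/\ embeds G H, k_generated 4 H,
            product_variety M (abelian_exp_variety (e ^ m.+1)) H
          & has_exponent (e ^ m.+2) H])
  /\
  (* (2) *)
  (forall (M : group_class) (G : finGroupType),
      is_variety M -> M G ->
      exists H : finGroupType,
        [/\ embeds G H, k_generated 4 H
          & product_variety M abelian_variety H])
  /\
  (forall (l : nat) (G : finGroupType),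
      solvable [set: G] -> has_derived_length l G ->
      exists H : finGroupType,
        [/\ embeds G H, k_generated 4 H, solvable [set: H]
          & has_derived_length l.+1 H])
  /\
  (forall (p l : nat) (G : finGroupType),
      prime p -> pgroup p [set: G] -> has_derived_length l G ->
      exists H : finGroupType,
        [/\ embeds G H, k_generated 4 H, pgroup p [set: H]
          & has_derived_length l.+1 H]).
Proof.
have enum_gen (G : finGroupType) (S : {pred G}) : group_closed S ->
    (forall k, k < #|G| -> nth 1%g (enum G) k \in S) -> forall g, g \in S.
  move=> _ enumS g; rewrite -(nth_index 1%g (mem_enum G g)); apply: enumS.
  by rewrite cardE index_mem mem_enum.
(* Some c > 1 makes the exponent greater than 1 even when G is trivial. *)
have cardX (G : finGroupType) c : has_exponent (c * #|G|) G.
  move=> g; rewrite mulnC expgnA (_ : (g ^+ #|G|)%g = 1%g) ?expg1n //.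
  by rewrite -cardsT expg_cardG ?inE.
have cardG_gt0 (G : finGroupType) : 0 < #|G| by rewrite -cardsT cardG_gt0.
split=> [M G m e vM MG [y y_gen] e_gt0 Ge|].
  pose x k := oapp y 1%g (insub k).
  have x_gen (S : {pred G}) : group_closed S ->
      (forall k, k < m -> x k \in S) -> forall g, g \in S.
    move=> clS xS; apply: y_gen => // i.
    by have := xS i (ltn_ord i); rewrite /x valK.
  exists (generated (wreath_gens m e x)); split.
  - exact: embedding_embeds Ge x_gen.
  - exact: generated_k_generated.
  - exact: product_wreath.
  - exact: wreath_exponent.
split=> [M G vM MG|].
  have e_gt0 : 0 < 1 * #|G| by rewrite mul1n.
  exists (finite_wreath_subgroup #|G| (1 * #|G|) (nth 1%g (enum G))); split.
  - exact: embedding_embeds e_gt0 (cardX G 1) (enum_gen G).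
  - exact: generated_k_generated.
  have [K [MK [abK _]]] := product_wreath #|G| (nth 1%g (enum G)) e_gt0 vM MG.
  by exists K.
split=> [l G solG Gl|p l G p_pr pG Gl].
  have e_gt0 : 0 < 2 * #|G| by rewrite muln_gt0 cardG_gt0.
  have e_gt1 : 1 < 2 * #|G| by rewrite (leq_mul (leqnn 2) (cardG_gt0 G)).
  have Hl := wreath_derived_length e_gt0 (cardX G 2) (enum_gen G) e_gt1 Gl.
  exists (finite_wreath_subgroup #|G| (2 * #|G|) (nth 1%g (enum G))).
  split=> //.
  - exact: embedding_embeds e_gt0 (cardX G 2) (enum_gen G).
  - exact: generated_k_generated.
  by apply/derivedP; exists l.+1; case: Hl.
have e_gt0 : 0 < p * #|G| by rewrite muln_gt0 prime_gt0 ?cardG_gt0.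
have e_gt1 : 1 < p * #|G| by rewrite (leq_trans (prime_gt1 p_pr)) // leq_pmulr.
have Hl := wreath_derived_length e_gt0 (cardX G p) (enum_gen G) e_gt1 Gl.
exists (finite_wreath_subgroup #|G| (p * #|G|) (nth 1%g (enum G))); split=> //.
- exact: embedding_embeds e_gt0 (cardX G p) (enum_gen G).
- exact: generated_k_generated.
rewrite -pnat_exponent; apply: (@pnat_dvd _ ((p * #|G|) ^ #|G|.+2)).
  apply/exponentP => u _; exact: (wreath_exponent e_gt0 (cardX G p)).
by rewrite pnatX pnatM pnat_id // -cardsT [p.-nat _]pG.
Qed.
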